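(* Let $r\ge\beta_1(1)+1$ and fix a mesh $\Delta=(\Delta x,\Delta t)$ as described in the context. Then for each $c\in[c_0,c_1]$ there exists a constant $\bar h_\Delta(c)\in\mathbb R$ such that if $h(c)=\bar h_\Delta(c)$, then there is a fixed point $\bar v^0_\Delta\in Lip_r(\mathbb T)$ of $\psi^1_\Delta(\cdot;c)$, which yields a time periodic difference solution $\psi^t_\Delta(\bar v^0_\Delta;c)$ (of period one in $t$). Such a periodic solution is unique with respect to $c$ up to constants. Any other solution $\psi^t_\Delta(v^0;c)$, $v^0\in Lip_r(\mathbb T)$ (with $h(c)=\bar h_\Delta(c)$), exponentially falls into a periodic state; namely, for the constants $\rho\in(0,1)$ and $a>0$ of the context and for some $d\in\mathbb R$ depending on $(v^0;c)$, $$\|\psi^t_\Delta(v^0;c)-\psi^t_\Delta(\bar v^0_\Delta+dI_1;c)\|_{C^0}\le a\rho^t\quad\text{for all }t\in\mathbb N,$$ where $I_1(x):=1$ and $\psi^t_\Delta(v^0+dI_1;c)=\psi^t_\Delta(v^0;c)+dI_1$.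
   Context: $\mathbb T=\mathbb R/\mathbb Z$. The function $H=H(x,t,p):\mathbb T^2\times\mathbb R\to\mathbb R$ satisfies: (A1) $H$ is $C^2$; (A2) $H_{pp}>0$; (A3) $\lim_{|p|\to\infty}H(x,t,p)/|p|=+\infty$; (A4) the Legendre transform $L(x,t,\xi)=\sup_{p}\{\xi p-H(x,t,p)\}$ satisfies $|L_x|\le\alpha(|L|+1)$ for some $\alpha>0$. Real numbers $r>0$, $c_0\le c_1$ are fixed. $L^\infty_{r,0}(\mathbb T)$: all $u^0\in L^\infty(\mathbb T)$ with $\|u^0\|_{L^\infty}\le r$ and $\int_{\mathbb T}u^0dx=0$. $Lip_r(\mathbb T)$: all Lipschitz functions on $\mathbb T$ with Lipschitz constant at most $r$. $\phi^t(u^0;c)=u(\cdot,t)$, where $u$ is the entropy solution of $u_t+H(x,t,c+u)_x=0$, $u(\cdot,0)=u^0$. Mesh: $N\le K$ are natural numbers, $\Delta x=(2N)^{-1}$, $\Delta t=(2K)^{-1}$, $\lambda=\Delta t/\Delta x$, $x_m=m\Delta x$, $t_k=k\Delta t$. Scheme for $u_t+H(x,t,c+u)_x=0$: $u^k_m$ ($m+k$ even) satisfies $$\frac{u^{k+1}_{m+1}-\frac{u^k_m+u^k_{m+2}}2}{\Delta t}+\frac{H(x_{m+2},t_k,c+u^k_{m+2})-H(x_m,t_k,c+u^k_m)}{2\Delta x}=0,\quad u^k_{m\pm2N}=u^k_m,$$ with $u^0_m=\frac1{2\Delta x}\int_{x_m-\Delta x}^{x_m+\Delta x}u^0dy$ ($m$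 even); $u_\Delta(x,t)=u^k_m$ on $[x_{m-1},x_{m+1})\times[t_k,t_{k+1})$ and $\phi^t_\Delta(u^0;c)=u_\Delta(\cdot,t)$. Scheme for $v_t+H(x,t,c+v_x)=h(c)$: $v^k_m$ ($m+k$ odd) satisfies $$\frac{v^{k+1}_m-\frac{v^k_{m-1}+v^k_{m+1}}2}{\Delta t}+H\Big(x_m,t_k,c+\frac{v^k_{m+1}-v^k_{m-1}}{2\Delta x}\Big)=h(c),\quad v^k_{m+1\pm2N}=v^k_{m+1},$$ with $v^0_{m+1}=v^0(x_{m+1})$ for $m$ even; $v_\Delta(x,t)=v^k_{m-1}+\frac{v^k_{m+1}-v^k_{m-1}}{2\Delta x}(x-x_{m-1})$ for $(x,t)\in[x_{m-1},x_{m+1})\times[t_k,t_{k+1})$ ($m+k$ even), and $\psi^t_\Delta(v^0;c)=v_\Delta(\cdot,t)$. If $u^0=v^0_x$ then $(v_\Delta)_x=u_\Delta$. Choice of $r$ and mesh: $\beta_1(1)>0$ is a constant, independent of $r$, $c\in[c_0,c_1]$ and the initial data, such that $\|\phi^1(u^0;c)\|_{L^\infty}\le\beta_1(1)$ for all $c\in[c_0,c_1]$ and all bounded zero-mean $u^0$. Constants $0<\lambda_0<\lambda_1$ and $\delta>0$ are fixed such that, for every mesh with $\lambda_0\le\lambda<\lambda_1$, $\Delta x\le\delta$, every $c\in[c_0,c_1]$ and every $u^0\in L^\infty_{r,0}(\mathbb T)$: (i) $|H_p(x_m,t_k,c+u^k_m)|\le\lambda_1^{-1}<\lambda^{-1}$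 for all $k\ge0$ and all $m$ with $m+k$ even; (ii) $\|\phi^1_\Delta(u^0;c)\|_{L^\infty}\le\beta_1(1)+1$, so $\phi^1_\Delta(\cdot;c)$ maps $L^\infty_{r,0}(\mathbb T)$ into itself. (Such constants exist by the paper's stability theory.) The fixed mesh satisfies $\lambda_0\le\lambda<\lambda_1$, $\Delta x\le\delta$. Constants $\rho,a$: the map $\phi^1_\Delta(\cdot;c)$ has a unique fixed point $\bar u^0_\Delta\in L^\infty_{r,0}(\mathbb T)$, and $\rho\in(0,1)$, $a>0$ are constants, depending on $\Delta$ but independent of $u^0$, such that $\|\phi^t_\Delta(u^0;c)-\phi^t_\Delta(\bar u^0_\Delta;c)\|_{L^\infty}\le a\rho^t$ for all $t\in\mathbb N$ and all $u^0\in L^\infty_{r,0}(\mathbb T)$ (such $\rho,a$ exist). *)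

(* Defs.v *)
From HB Require Import structures.
From mathcomp Require Import all_boot all_order all_algebra.
From mathcomp Require Import all_classical all_reals all_analysis.
From mathcomp Require Import ring lra.
Import Order.TTheory GRing.Theory Num.Theory.
Import numFieldNormedType.Exports.

Set Implicit Arguments.
Unset Strict Implicit.
Unset Printing Implicit Defensive.

Local Open Scope classical_set_scope.
Local Open Scope ring_scope.

(* Functions on the torus T = R/Z are represented by 1-periodic functions on R,
   and integrals over T by integrals over [0, 1]. *)

(* C^n regularity: on a finite-dimensional space, C^n.+1 means that all
   directional derivatives exist everywhere and are C^n functions. *)
Fixpoint Ck (R : realType) (V : normedModType R) (n : nat) (f : V -> R) : Prop :=
  continuous f /\
  if n is n'.+1 then
    forall v : V, (forall x, derivable f x v) /\ Ck n' (fun x => 'D_v f x)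
  else True.

Definition Legendre (R : realType) (H : R -> R -> R -> R) (x t xi : R) : R :=
  sup [set xi * p - H x t p | p in [set: R]].

Record Hamiltonian (R : realType) (H : R -> R -> R -> R) : Prop := {
  H_per_x : forall t p, periodic (fun x => H x t p) 1;
  H_per_t : forall x p, periodic (fun t => H x t p) 1;
  H_C2 : Ck 2 (fun z : R * R * R => H z.1.1 z.1.2 z.2);
  H_pp_gt0 : forall x t p, 0 < derive1n 2 (H x t) p;
  H_superlinear : forall x t,
    (H x t p / `|p| @[p --> +oo] --> +oo) /\
    (H x t p / `|p| @[p --> -oo] --> +oo);
  L_x_bound : exists2 alpha : R, 0 < alpha &
    forall x t xi, `|derive1 (fun y => Legendre H y t xi) x|
                   <= alpha * (`|Legendre H x t xi| + 1) }.

(* The L^oo norm over R of a 1-periodic function is its L^oo norm over T. *)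
Definition normLinf (R : realType) (f : R -> R) : \bar R :=
  ('N[@lebesgue_measure R]_(+oo) [EFin \o f])%E.

Definition normC0 (R : realType) (f : R -> R) : \bar R :=
  ereal_sup [set `|f x|%:E | x in [set: R]].

Definition Linf0 (R : realType) (u : R -> R) : Prop :=
  [/\ measurable_fun [set: R] u, periodic u 1, (normLinf u < +oo)%E &
      \int[@lebesgue_measure R]_(x in `[0, 1]) u x = 0].

Definition Linf_r0 (R : realType) (r : R) (u : R -> R) : Prop :=
  Linf0 u /\ (normLinf u <= r%:E)%E.

(* For a periodic function, the Lipschitz constants with respect to the
   distance of R and to the distance of T coincide. *)
Definition Lip_r (R : realType) (r : R) (v : R -> R) : Prop :=
  periodic v 1 /\ r.-lipschitz v.

Definition ae_equal (R : realType) (u v : R -> R) : Prop :=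
  {ae @lebesgue_measure R, forall x, u x = v x}.

(* Nonnegative smooth functions with compact support in T x (0, +oo). *)
Definition test_function (R : realType) (phi : R -> R -> R) : Prop :=
  [/\ forall n, Ck n (fun z : R * R => phi z.1 z.2),
      forall t, periodic (fun x => phi x t) 1,
      forall x t, 0 <= phi x t &
      exists a b : R, 0 < a /\ forall x t, ~~ (a <= t <= b) -> phi x t = 0].

(* Kruzhkov's notion: u = u(x, t) is the entropy solution of
   u_t + H(x, t, c + u)_x = 0 on T x [0, +oo), u(., 0) = u0.  The L^1
   continuity in time determines u(., t) up to a null set for every t. *)
Record entropy_solution (R : realType) (H : R -> R -> R -> R) (c : R)
    (u0 : R -> R) (u : R -> R -> R) : Prop := {
  ent_meas :
    measurable_fun ([set: R] `*` `[0 : R, +oo[ : set (R * R)) (fun z : R * R => u z.1 z.2);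
  ent_per : forall t, 0 <= t -> periodic (fun x => u x t) 1;
  ent_bounded : forall T : R, exists M : R, forall t, 0 <= t <= T ->
    (normLinf (fun x => u x t) <= M%:E)%E;
  ent_L1_continuous : forall t, 0 <= t ->
    \int[@lebesgue_measure R]_(x in `[0, 1]) `|u x s - u x t|
      @[s --> within `[0, +oo[ (nbhs t)] --> (0 : R);
  ent_initial : ae_equal (fun x => u x 0) u0;
  ent_ineq : forall (kappa : R) (phi : R -> R -> R), test_function phi ->
    0 <= \int[(@lebesgue_measure R \x @lebesgue_measure R)%E]_(z in
               `[0, 1] `*` `[0, +oo[)
      (let x := z.1 in let t := z.2 in
       `|u x t - kappa| * derive1 (phi x) t
       + Num.sg (u x t - kappa) * (H x t (c + u x t) - H x t (c + kappa))
         * derive1 (fun y => phi y t) x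
       - Num.sg (u x t - kappa) * derive1 (fun y => H y t (c + kappa)) x
         * phi x t) }.

Definition mesh_dx (R : realType) (N : nat) : R := (2 * N%:R)^-1.
Definition mesh_dt (R : realType) (K : nat) : R := (2 * K%:R)^-1.
Definition mesh_lambda (R : realType) (N K : nat) : R :=
  mesh_dt R K / mesh_dx R N.
Definition mesh_x (R : realType) (N : nat) (m : int) : R := m%:~R * mesh_dx R N.
Definition mesh_t (R : realType) (K k : nat) : R := k%:R * mesh_dt R K.

Definition admissible_mesh (R : realType) (lambda0 lambda1 delta : R)
    (N K : nat) : Prop :=
  [/\ (0 < N)%N, (N <= K)%N, lambda0 <= mesh_lambda R N K < lambda1 &
      mesh_dx R N <= delta].

(* u^k_m.  The explicit recursion is run for every (k, m); the values with
   m + k even and those with m + k odd do not interact. *)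
Fixpoint schemeU (R : realType) (H : R -> R -> R -> R) (N K : nat) (c : R)
    (u0 : R -> R) (k : nat) (m : int) : R :=
  if k is k'.+1 then
    let u := schemeU H N K c u0 k' in
    let x := mesh_x R N in
    let t := mesh_t R K k' in
    (u (m - 1) + u (m + 1)) / 2
    - mesh_dt R K * ((H (x (m + 1)) t (c + u (m + 1))
                      - H (x (m - 1)) t (c + u (m - 1))) / (2 * mesh_dx R N))
  else
    (2 * mesh_dx R N)^-1 *
    \int[@lebesgue_measure R]_(y in
        `[mesh_x R N m - mesh_dx R N, mesh_x R N m + mesh_dx R N]) u0 y.

(* v^k_m, with right-hand side h = h(c); only m + k odd is used. *)
Fixpoint schemeV (R : realType) (H : R -> R -> R -> R) (N K : nat) (c h : R)
    (v0 : R -> R) (k : nat) (m : int) : R :=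
  if k is k'.+1 then
    let v := schemeV H N K c h v0 k' in
    (v (m - 1) + v (m + 1)) / 2
    - mesh_dt R K * (H (mesh_x R N m) (mesh_t R K k')
                       (c + (v (m + 1) - v (m - 1)) / (2 * mesh_dx R N)) - h)
  else v0 (mesh_x R N m).

Definition time_index (R : realType) (K : nat) (t : R) : nat :=
  Num.truncn (t / mesh_dt R K).

(* The integer m with m + k even and x in [x_(m-1), x_(m+1)), see
   cell_index_even and cell_indexP. *)
Definition cell_index (R : realType) (N k : nat) (x : R) : int :=
  Posz k + 2 * Num.floor ((x / mesh_dx R N + 1 - k%:R) / 2).

Definition phi_Delta (R : realType) (H : R -> R -> R -> R) (N K : nat) (c t : R)
    (u0 : R -> R) : R -> R :=
  fun x => let k := time_index K t in
           schemeU H N K c u0 k (cell_index N k x).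

Definition psi_Delta (R : realType) (H : R -> R -> R -> R) (N K : nat)
    (c h t : R) (v0 : R -> R) : R -> R :=
  fun x => let k := time_index K t in
           let m := cell_index N k x in
           let v := schemeV H N K c h v0 k in
           v (m - 1) + (v (m + 1) - v (m - 1)) / (2 * mesh_dx R N)
                       * (x - mesh_x R N (m - 1)).

(* beta bounds ||phi^1(u0; c)|| uniformly in c and u0; phi^1(u0; c) = u(., 1). *)
Definition entropy_bound (R : realType) (H : R -> R -> R -> R)
    (c0 c1 beta : R) : Prop :=
  forall c u0 u, c0 <= c <= c1 -> Linf0 u0 -> entropy_solution H c u0 u ->
    (normLinf (fun x => u x 1%R) <= beta%:E)%E.

Definition mesh_stability (R : realType) (H : R -> R -> R -> R)
    (c0 c1 beta r lambda0 lambda1 delta : R) : Prop :=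
  forall (N K : nat), admissible_mesh lambda0 lambda1 delta N K ->
  forall c, c0 <= c <= c1 -> forall u0, Linf_r0 r u0 ->
    (forall (k : nat) (m : int), (2 %| m + Posz k)%Z ->
       `|derive1 (H (mesh_x R N m) (mesh_t R K k))
           (c + schemeU H N K c u0 k m)| <= lambda1^-1
       /\ lambda1^-1 < (mesh_lambda R N K)^-1)
    /\ (normLinf (phi_Delta H N K c 1%R u0) <= (beta + 1)%:E)%E.

(* Elements of L^oo are compared almost everywhere. *)
Definition unique_fixed_point (R : realType) (H : R -> R -> R -> R) (N K : nat)
    (c r : R) (ubar : R -> R) : Prop :=
  [/\ Linf_r0 r ubar,
      ae_equal (phi_Delta H N K c 1 ubar) ubar &
      forall u, Linf_r0 r u -> ae_equal (phi_Delta H N K c 1 u) u ->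
        ae_equal u ubar].

Lemma schemeU_eq (R : realType) (H : R -> R -> R -> R) (N K : nat) (c : R)
    (u0 : R -> R) (k : nat) (m : int) : (0 < K)%N ->
  let u := schemeU H N K c u0 in
  let x := mesh_x R N in
  let t := mesh_t R K in
  (u k.+1 (m + 1) - (u k m + u k (m + 2)) / 2) / mesh_dt R K
  + (H (x (m + 2)) (t k) (c + u k (m + 2)) - H (x m) (t k) (c + u k m))
    / (2 * mesh_dx R N) = 0.
Proof.
move=> K0 u x t; rewrite {1}/u /=.
have -> : m + 1 - 1 = m by rewrite addrK.
have -> : m + 1 + 1 = m + 2 by rewrite -addrA.
rewrite addrAC subrr add0r mulNr mulrAC mulfV ?mul1r ?addNr //.
by rewrite invr_eq0 mulf_neq0 // pnatr_eq0 -lt0n.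
Qed.

Lemma schemeV_eq (R : realType) (H : R -> R -> R -> R) (N K : nat) (c h : R)
    (v0 : R -> R) (k : nat) (m : int) : (0 < K)%N ->
  let v := schemeV H N K c h v0 in
  (v k.+1 m - (v k (m - 1) + v k (m + 1)) / 2) / mesh_dt R K
  + H (mesh_x R N m) (mesh_t R K k)
      (c + (v k (m + 1) - v k (m - 1)) / (2 * mesh_dx R N)) = h.
Proof.
move=> K0 v; rewrite {1}/v /=.
rewrite addrAC subrr add0r mulNr mulrAC mulfV ?mul1r ?opprB ?subrK //.
by rewrite invr_eq0 mulf_neq0 // pnatr_eq0 -lt0n.
Qed.

Lemma cell_index_even (R : realType) (N k : nat) (x : R) :
  (2 %| cell_index N k x + Posz k)%Z.
Proof.
rewrite /cell_index; set q := Num.floor _.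
have -> : Posz k + 2 * q + Posz k = 2 * (Posz k + q) by ring.
exact: dvdz_mulr.
Qed.

Lemma cell_indexP (R : realType) (N k : nat) (x : R) : (0 < N)%N ->
  mesh_x R N (cell_index N k x - 1) <= x < mesh_x R N (cell_index N k x + 1).
Proof.
move=> N0.
have dx0 : 0 < mesh_dx R N by rewrite invr_gt0 mulr_gt0 // ltr0n.
rewrite /mesh_x -ler_pdivlMr // -ltr_pdivrMr // /cell_index.
set y := x / mesh_dx R N; set q := Num.floor _.
have := floor_itv ((y + 1 - k%:R) / 2); rewrite -/q => /andP[].
rewrite ler_pdivlMr // ltr_pdivrMr // !rmorphB !rmorphD !rmorphM /= => h1 h2.
rewrite -pmulrn; apply/andP; split; lra.
Qed.

(* Main.v *)
Require Import Defs.
From HB Require Import structures.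
From mathcomp Require Import all_boot all_order all_algebra.
From mathcomp Require Import all_classical all_reals all_analysis.
From mathcomp Require Import measurable_realfun ess_sup_inf ring lra zify.
Import Order.TTheory GRing.Theory Num.Theory.
Import numFieldNormedType.Exports.

Set Implicit Arguments.
Unset Strict Implicit.
Unset Printing Implicit Defensive.

Local Open Scope classical_set_scope.
Local Open Scope ring_scope.

(** The scheme for [u_t + H(x,t,c+u)_x = 0] is the space difference of the scheme
    for [v_t + H(x,t,c+v_x) = h], so the two carry the same information: the
    values [u] on the grid determine [v] up to one constant per time level, and
    that constant only sees [h] through an additive drift [h t].

    Existence.  The grid values of the fixed point [ubar] are 1-periodic in space,
    have zero mean and are bounded by [r]; summing them gives an [r]-Lipschitz
    piecewise linear [vbar] (lemma [Lip_interp_primitive]).  After one unit of time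
    the slopes of its evolution with right-hand side 0 return to their initial
    values, so the evolution itself returns up to a constant; choosing [hbar] as
    the opposite of this drift makes [vbar] a fixed point ([corrector_exists]).

    Convergence.  Two solutions [v], [w] of the second scheme satisfy a comparison
    principle ([schemeV_comparison]): by the mean value theorem [v - w] is updated
    by averages of its two neighbours, whose weights are nonnegative because the
    CFL condition bounds [H_p] at both slopes and [H_p] is monotone in between.
    Hence [max (v - w)] is nonincreasing and [min (v - w)] is nondecreasing in
    time, and there is one constant [d] lying between them at all times
    ([squeezed_constant]).  So [|v - w - d|] is at most the oscillation of [v - w],
    and on a circle of length one this is at most the maximal slope of [v - w],
    which is the distance of the two solutions of the first scheme, at most
    [a rho^t] at integer times ([corrector_attracts]).

    Uniqueness.  For a second periodic solution [w] the difference [w - vbar - d]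
    is the same at all integer times, and at most [a rho^t]; hence it vanishes.

    A Lipschitz [v0] enters the first scheme through the step function of its
    difference quotients on the cells instead of its derivative: the scheme only
    reads cell averages, which are the same for both ([Lip_step_slope]). *)

(** * Chords of the Hamiltonian in the momentum variable *)

(** The chord slope is a value of [f'] at an intermediate point, and [f'] is
    monotone, hence bounded there by its values at the two ends. *)
Lemma convex_chord_slope (R : realType) (f : R -> R) (a b M : R) :
  (forall p, derivable f p 1) -> (forall p, derivable (derive1 f) p 1) ->
  (forall p, 0 <= derive1n 2 f p) ->
  `|derive1 f a| <= M -> `|derive1 f b| <= M ->
  exists2 s, `|s| <= M & f b - f a = s * (b - a).
Proof.
move=> df ddf f2.
wlog ab : a b / a <= b => [wl|] Ma Mb.
  case: (leP a b) => [/wl|/ltW /wl]; first exact.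
  case=> // s sM e; exists s => //.
  by rewrite -opprB e; ring.
have cont (g : R -> R) : (forall p, derivable g p 1) ->
    {within `[a, b], continuous g}.
  move=> dg; apply: derivable_within_continuous => x _; exact: dg.
have [p pab e] : exists2 p, p \in `[a, b]%R & f b - f a = derive1 f p * (b - a).
  apply: MVT_segment => //; last exact: cont.
  by move=> x _; apply: DeriveDef => //; rewrite derive1E.
exists (derive1 f p) => //.
have mono : {in `[a, b]%R &, {homo derive1 f : x y / x <= y >-> x <= y}}.
  apply: ger0_derive1_le_cc; last exact: cont.
  - by move=> x _; exact: ddf.
  - by move=> x _; exact: f2.
move: (pab); rewrite in_itv /= => /andP[ap pb].
have h1 : derive1 f a <= derive1 f p by apply: mono => //; rewrite in_itv /= lexx.
have h2 : derive1 f p <= derive1 f b by apply: mono => //; rewrite in_itv /= lexx andbT.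
move: Ma Mb; rewrite !ler_norml => /andP[Ma _] /andP[_ Mb].
by rewrite (le_trans Ma h1) (le_trans h2 Mb).
Qed.

(** Regularity of [H] is expressed by directional derivatives on the product
    space; partial derivatives in [p] are those in the direction [(0, 0, 1)]. *)
Lemma derivable_last_coordinate (R : realType) (F : R * R * R -> R) (x t p : R) :
  derivable F (x, t, p) (0, 0, 1) ->
  derivable (fun q => F (x, t, q)) p 1 /\
  derive1 (fun q => F (x, t, q)) p = 'D_(0, 0, 1) F (x, t, p).
Proof.
rewrite derive1E /derivable /derive.
have -> : (fun h : R => h^-1 *: ((F \o shift (x, t, p)) (h *: (0, 0, 1)) - F (x, t, p)))
        = (fun h => h^-1 *: (((fun q => F (x, t, q)) \o shift p) (h *: 1)
                      - F (x, t, p))).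
  apply/funext => h /=; congr (_ *: (F _ - _)).
  by congr (_, _, _); rewrite /= scaler0 add0r.
by [].
Qed.

Lemma Hamiltonian_chord_slope (R : realType) (H : R -> R -> R -> R) :
  Hamiltonian H -> forall x t a b M,
  `|derive1 (H x t) a| <= M -> `|derive1 (H x t) b| <= M ->
  exists2 s, `|s| <= M & H x t b - H x t a = s * (b - a).
Proof.
case=> _ _ [_ /(_ (0, 0, 1))[dH [_ /(_ (0, 0, 1))[ddH _]]]] Hpp _ _ x t a b M.
have d1 p := derivable_last_coordinate (dH (x, t, p)).
have e1 : derive1 (H x t) = fun p =>
    'D_(0, 0, 1) (fun z : R * R * R => H z.1.1 z.1.2 z.2) (x, t, p).
  by apply/funext => p; exact: (d1 p).2.
apply: convex_chord_slope => p.
- exact: (d1 p).1.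
- by rewrite e1; exact: (derivable_last_coordinate (ddH (x, t, p))).1.
- exact: ltW (Hpp x t p).
Qed.

(** * The two schemes on the grid *)

Lemma mesh_dx_gt0 (R : realType) (N : nat) : (0 < N)%N -> 0 < mesh_dx R N.
Proof. by move=> N0; rewrite invr_gt0 mulr_gt0 // ltr0n. Qed.

Lemma mesh_dt_gt0 (R : realType) (K : nat) : (0 < K)%N -> 0 < mesh_dt R K.
Proof. exact: mesh_dx_gt0. Qed.

Lemma mesh_dxN (R : realType) (N : nat) : (0 < N)%N ->
  N%:R * (2 * mesh_dx R N) = 1.
Proof.
move=> N0; have Nn : (N%:R : R) != 0 by rewrite pnatr_eq0 -lt0n.
by rewrite /mesh_dx; field.
Qed.

Section Mesh_points.
Variables (R : realType) (N : nat).
Hypothesis N0 : (0 < N)%N.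
Local Notation dx := (mesh_dx R N).
Local Notation x_ := (mesh_x R N).

Lemma mesh_xD (m n : int) : x_ (m + n) = x_ m + n%:~R * dx.
Proof. by rewrite /mesh_x rmorphD mulrDl. Qed.

Lemma mesh_x_lt (m n : int) : (x_ m < x_ n) = (m < n).
Proof. by rewrite /mesh_x ltr_pM2r ?mesh_dx_gt0 // ltr_int. Qed.

Lemma mesh_x_le (m n : int) : (x_ m <= x_ n) = (m <= n).
Proof. by rewrite /mesh_x ler_pM2r ?mesh_dx_gt0 // ler_int. Qed.

Lemma mesh_x_period (m : int) : x_ (m + Posz (2 * N)) = x_ m + 1.
Proof.
rewrite mesh_xD; congr (_ + _).
by rewrite -[RHS](mesh_dxN R N0) -pmulrn natrM mulrCA mulrA.
Qed.

End Mesh_points.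

Definition slope (R : realType) (N : nat) (V : int -> R) (m : int) : R :=
  (V (m + 1) - V (m - 1)) / (2 * mesh_dx R N).

(** The sublattice of the [(k, m)] that carry the first scheme; the second scheme
    lives on the complementary sublattice, that is at the [m] with [active k.+1 m]. *)
Definition active (k : nat) (m : int) : bool := (2 %| m + Posz k)%Z.

Lemma active_period (k n K : nat) (m : int) :
  active (k + n * (2 * K)) m = active k m.
Proof. by apply/idP/idP; rewrite /active; lia. Qed.

Section Grid.
Variables (R : realType) (H : R -> R -> R -> R) (N K : nat) (c : R).

Local Notation U := (schemeU H N K c).
Local Notation V := (schemeV H N K c).
Local Notation dx := (mesh_dx R N).
Local Notation dt := (mesh_dt R K).

(** The first scheme is the difference quotient in space of the second one. *)
Lemma schemeU_slope (h : R) (u0 v0 : R -> R) : (0 < N)%N ->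
  (forall m, active 0 m -> U u0 0%N m = slope N (V h v0 0%N) m) ->
  forall k m, active k m -> U u0 k m = slope N (V h v0 k) m.
Proof.
move=> N0 e0; elim=> [|k IH] m; first exact: e0.
rewrite /active => mk /=.
rewrite !IH; [|rewrite /active; lia..].
rewrite [in RHS]/slope /= -/(slope N (V h v0 k) (m + 1)) -/(slope N (V h v0 k) (m - 1)).
set A := H _ _ _; set B := H _ _ _.
rewrite /slope ?addrK ?subrK.
have := mesh_dx_gt0 R N0; set d := mesh_dx R N => d0.
by field; rewrite gt_eqF.
Qed.

(** The second scheme depends on the unknown only through differences, so both a
    constant in the data and a change of right-hand side are just carried along. *)
Lemma schemeV_shift (h1 h2 d : R) (v0 w0 : R -> R) :
  (forall m, active 1 m -> V h1 v0 0%N m = V h2 w0 0%N m + d) ->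
  forall k m, active k.+1 m ->
    V h1 v0 k m = V h2 w0 k m + d + (h1 - h2) * (k%:R * dt).
Proof.
move=> e0; elim=> [|k IH] m mk; first by rewrite e0 // mul0r mulr0 addr0.
move: mk; rewrite /active => mk /=.
have [a1 a2] : active k.+1 (m - 1) /\ active k.+1 (m + 1)
  by split; rewrite /active; lia.
rewrite !IH //.
set e := (h1 - h2) * _.
rewrite (_ : forall a b : R, a + d + e - (b + d + e) = a - b); last by move=> a b; ring.
rewrite /e -natr1; set A := H _ _ _; by field.
Qed.

Lemma schemeV_addcst (h d : R) (v0 : R -> R) (k : nat) (m : int) :
  V h (v0 \+ cst d) k m = V h v0 k m + d.
Proof.
elim: k m => [//|k IH] m /=; rewrite !IH.
rewrite (_ : forall a b : R, a + d - (b + d) = a - b); last by move=> a b; ring.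
by set A := H _ _ _; field.
Qed.

Lemma schemeV_periodic_x (h : R) (v0 : R -> R) : Hamiltonian H -> (0 < N)%N ->
  periodic v0 1 ->
  forall k m, V h v0 k (m + Posz (2 * N)) = V h v0 k m.
Proof.
move=> hH N0 pv.
elim=> [|k IH] m /=; first by rewrite mesh_x_period // pv.
by rewrite !(addrAC m (Posz (2 * N)%N)) !IH mesh_x_period // (H_per_x hH).
Qed.

Lemma mesh_t_period (k : nat) : (0 < K)%N ->
  mesh_t R K (k + 2 * K) = mesh_t R K k + 1.
Proof.
move=> K0; rewrite /mesh_t natrD mulrDl; congr (_ + _).
by rewrite -[RHS](mesh_dxN R K0) natrM mulrCA mulrA.
Qed.

Lemma schemeV_periodic_t (h : R) (v0 : R -> R) : Hamiltonian H -> (0 < K)%N ->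
  (forall m, active 1 m -> V h v0 (2 * K)%N m = V h v0 0%N m) ->
  forall k m, active k.+1 m -> V h v0 (k + 2 * K)%N m = V h v0 k m.
Proof.
move=> hH K0 e0; elim=> [|k IH] m mk; first exact: e0.
move: mk; rewrite /active => mk.
have [a1 a2] : active k.+1 (m - 1) /\ active k.+1 (m + 1)
  by split; rewrite /active; lia.
by rewrite addSn /= !IH // mesh_t_period // (H_per_t hH).
Qed.

End Grid.

(** * Comparison principle *)

(** One step of the scheme for [v] (left) and for [w] (right), where [A - B] is the
    difference of the Hamiltonian terms written with a chord slope [s].  The update of
    [v - w] is an average with weights [(1 + s e / d) / 2] and [(1 - s e / d) / 2]. *)
Lemma Lax_Friedrichs_monotone (R : realFieldType) (vm vp wm wp C h d e s A B : R) :
  0 < d -> 0 < e -> `|s| <= d / e ->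
  A - B = s * ((vp - vm) / (2 * d) - (wp - wm) / (2 * d)) ->
  vm <= wm + C -> vp <= wp + C ->
  (vm + vp) / 2 - e * (A - h) <= (wm + wp) / 2 - e * (B - h) + C.
Proof.
move=> d0 e0 sM AB lem lep.
pose sg := s * e / d.
have /andP[sg1 sg2] : - 1 <= sg <= 1.
  rewrite -ler_norml /sg !normrM (gtr0_norm e0) (gtr0_norm (x := d^-1)) ?invr_gt0 //.
  by rewrite ler_pdivrMr // mul1r -ler_pdivlMr.
have eA : e * (A - h) = e * (B - h) + sg * ((vp - wp) - (vm - wm)) / 2.
  have -> : A = B + (A - B) by ring.
  by rewrite AB /sg; field; rewrite gt_eqF.
have p1 : 0 <= (1 + sg) * (wm + C - vm) by apply: mulr_ge0; lra.
have p2 : 0 <= (1 - sg) * (wp + C - vp) by apply: mulr_ge0; lra.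
have -> : (vm + vp) / 2 - e * (A - h) =
    (wm + wp) / 2 - e * (B - h) + C
    - ((1 + sg) * (wm + C - vm) + (1 - sg) * (wp + C - vp)) / 2.
  by rewrite eA; field.
by lra.
Qed.

Section Comparison.
Variables (R : realType) (H : R -> R -> R -> R) (N K : nat) (c : R).

Local Notation V := (schemeV H N K c).

Definition CFL (h : R) (v0 : R -> R) : Prop := forall k m, active k m ->
  `|derive1 (H (mesh_x R N m) (mesh_t R K k)) (c + slope N (V h v0 k) m)|
    <= (mesh_lambda R N K)^-1.

(** Started at an arbitrary level [k], so that bounds found at different times can
    be compared with each other. *)
Lemma schemeV_comparison (h C : R) (v0 w0 : R -> R) :
  Hamiltonian H -> (0 < N)%N -> (0 < K)%N -> CFL h v0 -> CFL h w0 ->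
  forall k j,
  (forall m, active k.+1 m -> V h v0 k m <= V h w0 k m + C) ->
  forall m, active (k + j).+1 m -> V h v0 (k + j) m <= V h w0 (k + j) m + C.
Proof.
move=> hH N0 K0 cv cw k; elim=> [|j IH]; first by rewrite addn0.
move=> /IH; rewrite addnS; set n := (k + j)%N => le m; rewrite /active => mn.
have [a1 [a2 a0]] : active n.+1 (m - 1) /\ active n.+1 (m + 1) /\ active n m.
  by split; [|split]; rewrite /active; lia.
have [s sM sE] := Hamiltonian_chord_slope hH (cw _ _ a0) (cv _ _ a0).
apply: (@Lax_Friedrichs_monotone _ _ _ _ _ _ _ (mesh_dx R N) (mesh_dt R K) s);
  rewrite ?mesh_dx_gt0 ?mesh_dt_gt0 ?le //.
- by rewrite -invf_div.
- by rewrite [LHS]sE /slope [in LHS]opprD addrACA subrr add0r.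
Qed.
End Comparison.

(** * Oscillation and the limiting constant *)

Lemma int_step_constant (T : Type) (F : int -> T) :
  (forall i, F (i + 1) = F i) -> forall i, F i = F 0.
Proof.
move=> FS; apply: int_ind => // n IH; rewrite -IH.
  by rewrite -(FS (Posz n)); congr F; lia.
by rewrite -(FS (- Posz n.+1)); congr F; lia.
Qed.

(** Up to a multiple of the period, [j] lies less than [N] steps to the right of [i]. *)
Lemma periodic_oscillation (R : realFieldType) (F : int -> R) (N : nat) (e : R) :
  (0 < N)%N -> (forall i, F (i + Posz N) = F i) ->
  (forall i, `|F (i + 1) - F i| <= e) ->
  forall i j, `|F i - F j| <= N%:R * e.
Proof.
move=> N0 Fper Fstep i j.
have per q i' : F (i' + q * Posz N) = F i'.
  have := @int_step_constant _ (fun q => F (i' + q * Posz N)) _ q.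
  rewrite mul0r addr0; apply => p.
  by rewrite mulrDl mul1r addrA Fper.
have walk (n : nat) : `|F i - F (i + Posz n)| <= n%:R * e.
  elim: n => [|n IH]; first by rewrite addr0 subrr normr0 mul0r.
  rewrite -natr1 mulrDl mul1r (_ : i + Posz n.+1 = i + Posz n + 1); last by lia.
  rewrite (le_trans (ler_distD (F (i + Posz n)) _ _)) // lerD //.
  by rewrite distrC.
have e0 : 0 <= e by rewrite (le_trans _ (Fstep 0)).
have r0 := modz_ge0 (j - i) (_ : Posz N != 0).
have rN := ltz_pmod (j - i) (_ : 0 < Posz N).
have -> : F j = F (i + Posz `|((j - i) %% Posz N)%Z|).
  rewrite gez0_abs; last by apply: r0; lia.
  rewrite -[LHS](per (- ((j - i) %/ Posz N)%Z)); congr F.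
  have := divz_eq (j - i) (Posz N); lia.
rewrite (le_trans (walk _)) // ler_wpM2r // ler_nat.
by have := rN _; have := r0 _; lia.
Qed.

(** The least upper bound of [D t] decreases with [t] and stays above the greatest
    lower bound, which increases; a constant between the two families is within the
    oscillation of [D t] at every [t].  Taking the infimum of all upper bounds avoids
    passing to a limit in [t]. *)
Lemma squeezed_constant (R : realType) (I : Type) (i0 : I)
    (D : nat -> I -> R) (E : nat -> R) :
  (forall t i j, D t i - D t j <= E t) ->
  (forall t s C, (forall i, D t i <= C) -> forall i, D (t + s)%N i <= C) ->
  (forall t s C, (forall i, C <= D t i) -> forall i, C <= D (t + s)%N i) ->
  exists d, forall t i, `|D t i - d| <= E t.
Proof.
move=> osc up lo.
pose S := [set C | exists t, forall i, D t i <= C].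
have lbS t C : (forall i, C <= D t i) -> lbound S C.
  move=> CD B [s sB].
  by apply: le_trans (lo t s C CD i0) _; rewrite addnC; apply: up.
have inS t j : S (D t j + E t).
  by exists t => i; rewrite addrC -lerBlDr.
have lb t j : lbound S (D t j - E t).
  by apply: lbS => i; rewrite lerBlDr addrC -lerBlDr.
exists (inf S) => t i; rewrite ler_distl; apply/andP; split.
  rewrite lerBlDr; apply: ge_inf; last exact: inS.
  by exists (D t i - E t).
rewrite -lerBlDr; apply: lb_le_inf => //.
by exists (D t i + E t).
Qed.

(** * Cells and piecewise linear interpolation *)

Section Interpolation.
Variables (R : realType) (N : nat).
Hypothesis N0 : (0 < N)%N.
Local Notation dx := (mesh_dx R N).
Local Notation x_ := (mesh_x R N).

Lemma cell_index_eq (k : nat) (m : int) (x : R) : active k m ->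
  x_ (m - 1) <= x < x_ (m + 1) -> cell_index N k x = m.
Proof.
move=> am /andP[mx xm].
have := cell_index_even N k x; have := cell_indexP k x N0.
set m' := cell_index N k x => /andP[mx' xm'].
have := le_lt_trans mx xm'; have := le_lt_trans mx' xm.
rewrite !mesh_x_lt //; move: am; rewrite /active; lia.
Qed.

Lemma cell_index_active (k : nat) (x : R) : active k (cell_index N k x).
Proof. exact: cell_index_even. Qed.

Lemma cell_index_period (k : nat) (x : R) :
  cell_index N k (x + 1) = cell_index N k x + Posz (2 * N).
Proof.
have := cell_index_active k x; have := cell_indexP k x N0.
set m := cell_index N k x => xm am; apply: cell_index_eq.
  by move: am; rewrite /active; lia.
by rewrite !(addrAC m (Posz (2 * N)%N)) !mesh_x_period // lerD2r ltrD2r.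
Qed.

Lemma cell_index_parity (k j : nat) (x : R) : odd k = odd j ->
  cell_index N k x = cell_index N j x.
Proof.
move=> kj; apply: cell_index_eq; last exact: cell_indexP.
have := cell_index_active j x; rewrite /active; lia.
Qed.

Lemma cell_index_left (k : nat) (m : int) : active k m ->
  cell_index N k (x_ (m - 1)) = m.
Proof. by move=> am; apply: cell_index_eq => //; rewrite ?mesh_x_le ?mesh_x_lt //; lia. Qed.

Definition interp (k : nat) (V : int -> R) : R -> R := fun x =>
  let m := cell_index N k x in
  V (m - 1) + slope N V m * (x - x_ (m - 1)).

Lemma psi_DeltaE (H : R -> R -> R -> R) (K : nat) (c h t : R) (v0 : R -> R) :
  psi_Delta H N K c h t v0
  = interp (time_index K t) (schemeV H N K c h v0 (time_index K t)).
Proof. by []. Qed.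

Lemma interp_node (k : nat) (V : int -> R) (m : int) : active k.+1 m ->
  interp k V (x_ m) = V m.
Proof.
rewrite /active => am; rewrite /interp -[in cell_index _ _ _](addrK 1 m).
rewrite cell_index_left; last by rewrite /active; lia.
by rewrite addrK subrr mulr0 addr0.
Qed.

(** The weight depends on [x] alone, which makes interpolation affine, monotone and
    nonexpansive in the nodal values. *)
Lemma interp_convex (k : nat) (x : R) : exists (m : int) (th : R),
  [/\ active k.+1 (m - 1), active k.+1 (m + 1), 0 <= th <= 1 &
      forall V, interp k V x = (1 - th) * V (m - 1) + th * V (m + 1)].
Proof.
exists (cell_index N k x), ((x - x_ (cell_index N k x - 1)) / (2 * dx)).
have := cell_index_active k x; have := cell_indexP k x N0.
rewrite /interp; set m := cell_index N k x => /andP[mx xm] am.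
have d0 : 0 < 2 * dx by rewrite mulr_gt0 // mesh_dx_gt0.
split; [by move: am; rewrite /active; lia|by move: am; rewrite /active; lia| |].
  rewrite divr_ge0 ?subr_ge0 ?(ltW d0) //= ler_pdivrMr // mul1r lerBlDl.
  rewrite (le_trans (ltW xm)) // (_ : m + 1 = m - 1 + 2); last by lia.
  by rewrite mesh_xD.
move=> V; rewrite /slope; move: d0; set d := 2 * dx => d0.
by field; rewrite gt_eqF.
Qed.

Lemma eq_interp (k : nat) (V W : int -> R) :
  (forall m, active k.+1 m -> V m = W m) -> interp k V = interp k W.
Proof.
move=> VW; apply/funext => x.
by have [m [th [a1 a2 _ E]]] := interp_convex k x; rewrite !E !VW.
Qed.

Lemma interp_addcst (k : nat) (V : int -> R) (d : R) :
  interp k (fun m => V m + d) = interp k V \+ cst d.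
Proof.
apply/funext => x.
by have [m [th [_ _ _ E]]] := interp_convex k x; rewrite /= !E; ring.
Qed.

Lemma interp_dist (k : nat) (V W : int -> R) (e x : R) :
  (forall m, active k.+1 m -> `|V m - W m| <= e) ->
  `|interp k V x - interp k W x| <= e.
Proof.
move=> VW; have [m [th [a1 a2 /andP[t0 t1] E]]] := interp_convex k x.
rewrite !E.
rewrite (_ : _ - _ = (1 - th) * (V (m - 1) - W (m - 1)) + th * (V (m + 1) - W (m + 1)));
  last by ring.
rewrite (_ : e = (1 - th) * e + th * e); last by ring.
rewrite (le_trans (ler_normD _ _)) // !normrM.
rewrite (ger0_norm t0) (@ger0_norm _ (1 - th)) ?subr_ge0 //.
by rewrite lerD // ler_wpM2l ?subr_ge0 // VW.
Qed.

Lemma interp_periodic (k : nat) (V : int -> R) :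
  (forall m, active k.+1 m -> V (m + Posz (2 * N)) = V m) ->
  periodic (interp k V) 1.
Proof.
move=> pV x; rewrite /interp /slope cell_index_period.
have := cell_index_active k x; set m := cell_index N k x => am.
rewrite !(addrAC m (Posz (2 * N)%N)) !pV ?(mesh_x_period R N0);
  [|by move: am; rewrite /active; lia..].
by rewrite opprD addrACA subrr addr0.
Qed.

(** Between points of different cells, go through the right end of the first cell and
    the left end of the last one. *)
Lemma interp_lipschitz (k : nat) (V : int -> R) (r : R) :
  (forall m, active k m -> `|slope N V m| <= r) ->
  r.-lipschitz (interp k V).
Proof.
move=> sr.
have d0 : 0 < 2 * dx by rewrite mulr_gt0 // mesh_dx_gt0.
have nodes (m : int) (n : nat) : active k.+1 m ->
    `|V (m + Posz (2 * n)) - V m| <= r * (x_ (m + Posz (2 * n)) - x_ m).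
  rewrite /active => am; elim: n => [|n IH].
    by rewrite muln0 addr0 !subrr normr0 mulr0.
  rewrite (_ : m + Posz (2 * n.+1) = m + Posz (2 * n) + 2); last by lia.
  have : active k (m + Posz (2 * n) + 1) by rewrite /active; lia.
  move: (m + Posz (2 * n)) IH => j IH aj.
  rewrite (_ : V (j + 2) - V m = V (j + 2) - V j + (V j - V m)); last by ring.
  rewrite (_ : x_ (j + 2) - x_ m = 2 * dx + (x_ j - x_ m)); last by rewrite mesh_xD; ring.
  rewrite (le_trans (ler_normD _ _)) // mulrDr lerD //.
  have := sr _ aj; rewrite /slope addrK normrM normfV (gtr0_norm d0).
  by rewrite ler_pdivrMr // -addrA.
  have mono x y : x <= y -> `|interp k V y - interp k V x| <= r * (y - x).
  move=> xy; rewrite /interp.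
  have := cell_index_active k x; have := cell_indexP k x N0.
  have := cell_index_active k y; have := cell_indexP k y N0.
  set p := cell_index N k x; set q := cell_index N k y.
  move=> /andP[qy yq] aq /andP[px xp] ap.
  have := le_lt_trans px (le_lt_trans xy yq); rewrite mesh_x_lt // => pq.
  have [e|neq] := eqVneq p q.
    rewrite e (_ : _ - _ = slope N V q * (y - x)); last by ring.
    by rewrite normrM (ger0_norm (x := y - x)) ?subr_ge0 // ler_wpM2r ?subr_ge0 // sr.
  have [n en] : exists n : nat, q - 1 = p + 1 + Posz (2 * n).
    exists (`|q - p|%N./2.-1); move: ap aq neq pq; rewrite /active; lia.
  have Vp : V (p + 1) = V (p - 1) + slope N V p * (2 * dx).
    by rewrite /slope mulfVK ?gt_eqF //; ring.
  have ep : x_ (p + 1) = x_ (p - 1) + 2 * dx.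
    by rewrite (_ : p + 1 = p - 1 + 2) ?mesh_xD //; lia.
  have b1 : `|slope N V q * (y - x_ (q - 1))| <= r * (y - x_ (q - 1)).
    by rewrite normrM (ger0_norm (x := y - _)) ?subr_ge0 // ler_wpM2r ?subr_ge0 // sr.
  have b2 : `|V (q - 1) - V (p + 1)| <= r * (x_ (q - 1) - x_ (p + 1)).
    by rewrite en nodes //; move: ap; rewrite /active; lia.
  have b3 : `|slope N V p * (x_ (p + 1) - x)| <= r * (x_ (p + 1) - x).
    have xp' : 0 <= x_ (p + 1) - x by rewrite subr_ge0 ltW.
    by rewrite normrM (ger0_norm xp') ler_wpM2r // sr.
  rewrite (_ : _ - _ = slope N V q * (y - x_ (q - 1)) + (V (q - 1) - V (p + 1))
     + slope N V p * (x_ (p + 1) - x)); last by rewrite Vp ep; ring.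
  rewrite (_ : r * (y - x) = r * (y - x_ (q - 1)) + r * (x_ (q - 1) - x_ (p + 1))
     + r * (x_ (p + 1) - x)); last by ring.
  rewrite (le_trans (ler_normD _ _)) // lerD //.
  by rewrite (le_trans (ler_normD _ _)) // lerD.
move=> [x y] _ /=; case: (leP x y) => [xy|/ltW yx].
  by rewrite distrC (distrC x) (ger0_norm (x := y - x)) ?subr_ge0 // mono.
by rewrite (ger0_norm (x := x - y)) ?subr_ge0 // mono.
Qed.
End Interpolation.

(** * Null sets, translations and integrals *)

Section Almost_everywhere.
Variable R : realType.
Local Notation mu := (@lebesgue_measure R).

Lemma lebesgue_measure_shift (a : R) (A : set R) : measurable A ->
  mu ((fun x => x + a) @^-1` A) = mu A.
Proof.
have ms : measurable_fun [set: R] (fun x : R => x + a : measurableTypeR R).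
  exact: measurable_funD.
move=> mA; pose M := pushforward mu (fun x : R => x + a : measurableTypeR R).
rewrite -[LHS]/(M A).
apply/esym/lebesgue_measure_unique => //= _ [[p q]] _ <-.
rewrite /M /pushforward.
rewrite (_ : _ @^-1` _ = `]p - a, q - a]%classic); last first.
  by apply/seteqP; split => x /=; rewrite !in_itv /= ltrBlDr lerBrDr.
by rewrite !lebesgue_measure_itv /= !lte_fin ltrD2r -!EFinB opprB addrA subrK.
Qed.

Lemma ae_imply (P Q : R -> Prop) : (forall x, P x -> Q x) ->
  {ae mu, forall x, P x} -> {ae mu, forall x, Q x}.
Proof. by move=> PQ; apply: negligibleS => x /= NQ /PQ. Qed.

Lemma ae_imply2 (P Q S : R -> Prop) : (forall x, P x -> Q x -> S x) ->
  {ae mu, forall x, P x} -> {ae mu, forall x, Q x} -> {ae mu, forall x, S x}.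
Proof.
move=> PQS aeP aeQ; apply: negligibleS (negligibleU aeP aeQ) => x /= NS.
by apply: contrapT => /not_orP[/contrapT Px /contrapT Qx]; apply: NS; exact: PQS.
Qed.

Lemma ae_shift (a : R) (P : R -> Prop) :
  {ae mu, forall x, P x} -> {ae mu, forall x, P (x + a)}.
Proof.
move=> [A [mA A0 PA]]; exists ((fun x => x + a) @^-1` A); split.
- rewrite -[X in measurable X]setTI.
  have ms : measurable_fun [set: R] (fun x : R => x + a) by exact: measurable_funD.
  exact: ms.
- by rewrite lebesgue_measure_shift.
- by move=> x /= Px; apply: PA.
Qed.

(** Turns almost everywhere statements on step functions into statements on their
    values: a cell is not a null set. *)
Lemma ae_itv_witness (a b : R) (P : R -> Prop) : a < b ->
  {ae mu, forall x, P x} -> exists2 x, a <= x < b & P x.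
Proof.
move=> ab aeP; apply: contrapT => noP.
have : mu `[a, b[%classic = 0%E.
  apply: measure_negligible => //; apply: negligibleS aeP => x /=.
  rewrite in_itv /= => xab Px; apply: noP; by exists x.
rewrite lebesgue_measure_itv /= lte_fin ab -EFinB => /eqP.
by rewrite eqe subr_eq0 gt_eqF.
Qed.

Lemma normLinf_leP (f : R -> R) (M : R) :
  (normLinf f <= M%:E)%E <-> {ae mu, forall x, `|f x| <= M}.
Proof.
rewrite /normLinf unlock.
have -> : (0 < mu [set: R])%E.
  have -> : [set: R] = `]-oo, +oo[%classic by apply/seteqP; split.
  by rewrite lebesgue_measure_itv /= addye // ltry.
split.
  by move=> /ess_supP; apply: filterS => x /=; rewrite lee_fin.
by move=> fM; apply/ess_supP; apply: ae_imply fM => x /=; rewrite lee_fin.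
Qed.

Lemma lebesgue_measure_itv_lty (l r : bool) (a b : R) :
  (mu [set` Interval (BSide l a) (BSide r b)] < +oo)%E.
Proof. by rewrite lebesgue_measure_itv /=; case: ifP => _ //; rewrite -EFinB ltry. Qed.

Lemma fine_lebesgue_measure_itv (l r : bool) (a b : R) : a <= b ->
  fine (mu [set` Interval (BSide l a) (BSide r b)]) = b - a.
Proof.
rewrite lebesgue_measure_itv /= lte_fin le_eqVlt => /predU1P[->|->] //=.
by rewrite ltxx subrr.
Qed.

Lemma eq_ae_Rintegral (D : set R) (f g : R -> R) : measurable D ->
  measurable_fun D f -> measurable_fun D g -> {ae mu, forall x, D x -> f x = g x} ->
  \int[mu]_(x in D) f x = \int[mu]_(x in D) g x.
Proof.
move=> mD mf mg fg; rewrite /Rintegral; congr fine.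
apply: ae_eq_integral => //; try exact/measurable_EFinP.
by apply: ae_imply fg => x /= fg Dx; rewrite fg.
Qed.

End Almost_everywhere.

(** * Step functions on the cells *)

Section Step.
Variables (R : realType) (N : nat).
Hypothesis N0 : (0 < N)%N.
Local Notation dx := (mesh_dx R N).
Local Notation x_ := (mesh_x R N).
Local Notation mu := (@lebesgue_measure R).

Definition step (g : int -> R) : R -> R := fun x => g (cell_index N 0 x).

(** On even time levels the cells are those of level 0; these levels include all
    integer times. *)
Lemma phi_DeltaE (H : R -> R -> R -> R) (K : nat) (c t : R) (u0 : R -> R) :
  ~~ odd (time_index K t) ->
  phi_Delta H N K c t u0 = step (schemeU H N K c u0 (time_index K t)).
Proof.
move=> ek; apply/funext => x; rewrite /phi_Delta /step.
by rewrite (@cell_index_parity _ _ N0 (time_index K t) 0) // (negbTE ek).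
Qed.

Lemma measurable_step (g : int -> R) : measurable_fun [set: R] (step g).
Proof.
move=> _ Y mY; rewrite setTI.
have -> : step g @^-1` Y = \bigcup_(m : int)
    (if asbool (active 0 m /\ Y (g m)) then `[x_ (m - 1), x_ (m + 1)[%classic else set0).
  apply/seteqP; split => x /=.
    move=> Yx; exists (cell_index N 0 x) => //.
    rewrite asboolT; first by rewrite /= in_itv /= cell_indexP.
    by split => //; exact: cell_index_active.
  move=> [m _]; case: asboolP => // -[am Ym] /=; rewrite in_itv /= => xm.
  by rewrite /step (@cell_index_eq _ _ N0 0 m).
apply: countable_bigcupT_measurable => // m.
by case: asboolP => // _.
Qed.

Lemma ae_step (g : int -> R) (P : R -> R -> Prop) (m : int) : active 0 m ->
  {ae mu, forall x, P x (step g x)} ->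
  exists2 x, x_ (m - 1) <= x < x_ (m + 1) & P x (g m).
Proof.
move=> am /(@ae_itv_witness _ (x_ (m - 1)) (x_ (m + 1)))[|x xm Px].
  by rewrite mesh_x_lt //; lia.
by exists x => //; move: Px; rewrite /step (@cell_index_eq _ _ N0 0 m).
Qed.

Lemma step_periodic (g : int -> R) :
  (forall m, active 0 m -> g (m + Posz (2 * N)) = g m) -> periodic (step g) 1.
Proof.
by move=> pg x; rewrite /step cell_index_period // pg //; exact: cell_index_active.
Qed.

Lemma normLinf_step (g : int -> R) (M : R) :
  (normLinf (step g) <= M%:E)%E <-> (forall m, active 0 m -> `|g m| <= M).
Proof.
split => [/normLinf_leP gM m am|gM].
  by have [x] := ae_step (P := fun _ y => `|y| <= M) am gM.
apply/normLinf_leP; apply: aeW => x; exact: gM (cell_index_active _ _ _).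
Qed.

Lemma Rintegral_step_cell (g : int -> R) (m : int) (l : bool) (a b : R) :
  active 0 m -> x_ (m - 1) <= a -> a <= b -> b <= x_ (m + 1) ->
  \int[mu]_(x in [set` Interval (BSide l a) (BRight b)]) step g x = g m * (b - a).
Proof.
move=> am ma ab bm.
rewrite (@eq_ae_Rintegral _ _ _ (cst (g m))) //.
- by rewrite Rintegral_cst //; congr (_ * _); exact: fine_lebesgue_measure_itv.
- by apply: measurable_funS (measurable_step g).
- exists [set b]; split => //; first exact: lebesgue_measure_set1.
  move=> x /= /not_implyP[]; rewrite in_itv /= => /andP[ax xb] gx.
  apply: contrapT => /eqP xb'; apply: gx; rewrite /step (@cell_index_eq _ _ N0 0 m) //.
  apply/andP; split.
    by apply: le_trans ma _; case: l ax => [|/ltW].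
  by apply: lt_le_trans bm; rewrite lt_neqAle xb' xb.
Qed.

(** The unit interval starts in the middle of the cell centred at 0, so it is cut into
    half cells; periodicity of [g] pairs the first half cell with the last one. *)
Lemma Rintegral_step_period (g : int -> R) (M : R) :
  (forall m, active 0 m -> `|g m| <= M) ->
  (forall m, active 0 m -> g (m + Posz (2 * N)) = g m) ->
  \int[mu]_(x in `[0, 1]) step g x = (2 * dx) * \sum_(i < N) g (Posz (2 * i)).
Proof.
move=> gM pg.
have int01 (n : nat) : mu.-integrable `[0, x_ (Posz n)]%classic (EFin \o step g).
  apply: measurable_bounded_integrable => //.
  - exact: lebesgue_measure_itv_lty.
  - exact: measurable_funS (measurable_step g).
  - exists M; split; first exact: num_real.
    move=> B MB x _ /=; rewrite (le_trans _ (ltW MB)) // gM //.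
    exact: cell_index_active.
have x0 (n : nat) : 0 <= x_ (Posz n).
  by rewrite mulr_ge0 ?(ltW (mesh_dx_gt0 R N0)).
(* The interval between the nodes j and j + 1 is half of the cell whose centre is
   the even one of the two, namely 2 * uphalf j. *)
have half (n : nat) : \int[mu]_(x in `[0, x_ (Posz n)]) step g x =
    dx * \sum_(j < n) g (Posz (2 * uphalf j)).
  elim: n => [|n IH].
    by rewrite big_ord0 mulr0 /mesh_x mul0r set_itv1 Rintegral_set1.
  rewrite big_ord_recr /= mulrDr -IH.
  apply/eqP; rewrite addrC -subr_eq; apply/eqP.
  have nn : x_ (Posz n) <= x_ (Posz n.+1) by rewrite mesh_x_le //; lia.
  rewrite Rintegral_itvB ?bnd_simp //.
  rewrite (@Rintegral_step_cell _ (Posz (2 * uphalf n))) ?mesh_x_le //; try lia.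
    rewrite (_ : x_ (Posz n.+1) - x_ (Posz n) = dx) 1?mulrC //.
    by rewrite -addn1 PoszD mesh_xD mul1r; ring.
  by rewrite /active; lia.
have e1 : 1 = x_ (Posz (2 * N)).
  by rewrite -[Posz _]add0r mesh_x_period // /mesh_x mul0r add0r.
rewrite [in LHS]e1 half.
rewrite (_ : \sum_(j < 2 * N) _ =
  \sum_(i < N) (g (Posz (2 * i)) + g (Posz (2 * i.+1)))).
  have E : \sum_(i < N) g (Posz (2 * i.+1)) = \sum_(i < N) g (Posz (2 * i)).
    apply/eqP; rewrite -subr_eq0 -sumrB.
    rewrite -(big_mkord xpredT (fun i => g (Posz (2 * i.+1)) - g (Posz (2 * i)))).
    rewrite (telescope_sumr (fun i => g (Posz (2 * i)))) //.
    by rewrite -[Posz (2 * N)]add0r pg // subrr.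
  by rewrite big_split /= E; ring.
elim: (N) => [|n IH]; first by rewrite !big_ord0.
rewrite [RHS]big_ord_recr /= -IH (_ : 2 * n.+1 = (2 * n).+2)%N; last by lia.
rewrite 2!big_ord_recr /= -addrA.
by congr (_ + (g _ + g _)); lia.
Qed.

(** The scheme reads only cell averages of its initial data. *)
Lemma schemeU0_step (H : R -> R -> R -> R) (K : nat) (c : R) (u : R -> R)
    (g : int -> R) : measurable_fun [set: R] u -> ae_equal (step g) u ->
  forall m, active 0 m -> schemeU H N K c u 0 m = g m.
Proof.
move=> mu' gu m am /=.
rewrite -(@eq_ae_Rintegral _ _ (step g)) //.
- rewrite (@Rintegral_step_cell _ m) //.
  + rewrite (_ : _ - _ = 2 * dx); last by ring.
    by rewrite mulrC mulfK // gt_eqF // mulr_gt0 // mesh_dx_gt0.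
  + by rewrite mesh_xD mulN1r.
  + have := mesh_dx_gt0 R N0; lra.
  + by rewrite mesh_xD mul1r.
- exact: measurable_funS (measurable_step g).
- exact: measurable_funS mu'.
- by apply: ae_imply gu => x.
Qed.

End Step.

(** * Time levels and initial data *)

Lemma time_indexS (R : realType) (K : nat) (t : R) : (0 < K)%N -> 0 <= t ->
  time_index K (t + 1) = (time_index K t + 2 * K)%N.
Proof.
move=> K0 t0; have dt0 := mesh_dt_gt0 R K0.
have e1 : 1 / mesh_dt R K = (2 * K)%:R by rewrite /mesh_dt div1r invrK natrM.
rewrite /time_index mulrDl e1; apply: truncn_def.
have /truncn_itv/andP[le lt] : 0 <= t / mesh_dt R K by rewrite divr_ge0 // ltW.
by rewrite -addSn !natrD lerD2r ltrD2r le lt.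
Qed.

Lemma time_index0 (R : realType) (K : nat) : time_index K (0 : R) = 0%N.
Proof. by rewrite /time_index mul0r truncn0. Qed.

Lemma time_index_nat (R : realType) (K n : nat) : (0 < K)%N ->
  time_index K (n%:R : R) = (n * (2 * K))%N.
Proof.
move=> K0; elim: n => [|n IH]; first by rewrite time_index0.
by rewrite -natr1 time_indexS // IH mulSn addnC.
Qed.

(** Partial sums over the residue modulo [N] are periodic by construction; the zero
    sum is what makes the increment right when the residue wraps around to 0. *)
Lemma discrete_antiderivative (R : realType) (N : nat) (s : int -> R) : (0 < N)%N ->
  (forall m, active 0 m -> s (m + Posz (2 * N)) = s m) ->
  \sum_(i < N) s (Posz (2 * i)) = 0 ->
  exists V : int -> R, (forall m, active 0 m -> slope N V m = s m) /\
    (forall m, V (m + Posz (2 * N)) = V m).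
Proof.
move=> N0 ps s0.
pose W (i : int) := (2 * mesh_dx R N) * \sum_(j < `|(i %% Posz N)%Z|) s (Posz (2 * j)).
have Wper i : W (i + Posz N) = W i by rewrite /W modzDr.
have perq q m : active 0 m -> s (m + q * Posz (2 * N)) = s m.
  move=> am.
  have := @int_step_constant _ (fun q => s (m + q * Posz (2 * N))) _ q.
  rewrite mul0r addr0; apply => p; rewrite mulrDl mul1r addrA ps //.
  by move: am; rewrite /active; lia.
have WS i : W (i + 1) - W i = (2 * mesh_dx R N) * s (2 * i).
  rewrite /W -mulrBr; congr (_ * _).
  have r0 : 0 <= (i %% Posz N)%Z by apply: modz_ge0; lia.
  have rN : (i %% Posz N)%Z < Posz N by apply: ltz_pmod; lia.
  have := divz_eq i (Posz N); set q := (i %/ Posz N)%Z.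
  move: r0 rN; case: (i %% Posz N)%Z => // r _ rN ei /=.
  have -> : s (2 * i) = s (Posz (2 * r)).
    by rewrite -[RHS](perq q); [congr s; rewrite ei; lia|rewrite /active; lia].
  have [rN1|rN1] := eqVneq r.+1 N.
    have -> : ((i + 1) %% Posz N)%Z = 0.
      by rewrite ei -addrA (_ : Posz r + 1 = Posz N) ?modzMDl ?modzz //; lia.
    rewrite big_ord0 sub0r; move: s0; rewrite -rN1 big_ord_recr /=.
    by move/eqP; rewrite addr_eq0 => /eqP ->; rewrite opprK.
  have -> : ((i + 1) %% Posz N)%Z = Posz r.+1.
    by rewrite ei -addrA modzMDl modz_small; lia.
  by rewrite big_ord_recr /= addrAC subrr add0r.
exists (fun m => W ((m + 1) %/ 2)%Z); split=> m.
  rewrite /active /slope => am.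
  have [i ->] : exists i : int, m = 2 * i by exists (m %/ 2)%Z; lia.
  rewrite (_ : (2 * i + 1 + 1) %/ 2 = i + 1)%Z; last by lia.
  rewrite (_ : (2 * i - 1 + 1) %/ 2 = i)%Z; last by lia.
  by rewrite WS mulrC mulKf // gt_eqF // mulr_gt0 // mesh_dx_gt0.
rewrite -[RHS]Wper; congr W; lia.
Qed.

Section Initial_data.
Variables (R : realType) (H : R -> R -> R -> R) (N K : nat) (c r : R).
Hypothesis N0 : (0 < N)%N.
Local Notation x_ := (mesh_x R N).
Local Notation samples v0 := (fun m : int => v0 (x_ m)).

Lemma samples_period (v0 : R -> R) (m : int) : periodic v0 1 ->
  v0 (x_ (m + Posz (2 * N))) = v0 (x_ m).
Proof. by move=> pv; rewrite mesh_x_period // pv. Qed.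

Lemma slope_period (V : int -> R) (m : int) :
  (forall m, V (m + Posz (2 * N)) = V m) ->
  slope N V (m + Posz (2 * N)) = slope N V m.
Proof. by move=> pV; rewrite /slope !(addrAC m (Posz (2 * N)%N)) !pV. Qed.

Lemma sum_slope_eq0 (V : int -> R) : (forall m, V (m + Posz (2 * N)) = V m) ->
  \sum_(i < N) slope N V (Posz (2 * i)) = 0.
Proof.
move=> pV; rewrite /slope -mulr_suml.
rewrite (eq_bigr (fun i : 'I_N => V (Posz (2 * i.+1) - 1) - V (Posz (2 * i) - 1)));
  last first.
  by move=> i _; congr (V _ - _); lia.
rewrite -(big_mkord xpredT (fun i => V (Posz (2 * i.+1) - 1) - V (Posz (2 * i) - 1))).
rewrite (telescope_sumr (fun i => V (Posz (2 * i) - 1))) //.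
rewrite (_ : Posz (2 * N) - 1 = Posz (2 * 0) - 1 + Posz (2 * N)); last by lia.
by rewrite pV subrr mul0r.
Qed.

Lemma Linf_r0_step (g : int -> R) :
  (forall m, active 0 m -> g (m + Posz (2 * N)) = g m) ->
  \sum_(i < N) g (Posz (2 * i)) = 0 ->
  (forall m, active 0 m -> `|g m| <= r) ->
  Linf_r0 r (step N g).
Proof.
move=> pg g0 gr; have gM := (normLinf_step N0 g r).2 gr.
split=> //; split=> //.
- exact: measurable_step.
- exact: step_periodic.
- exact: le_lt_trans gM (ltry _).
- by rewrite (Rintegral_step_period N0 gr) // g0 mulr0.
Qed.

Lemma Lip_interp_primitive (s : int -> R) :
  (forall m, active 0 m -> s (m + Posz (2 * N)) = s m) ->
  \sum_(i < N) s (Posz (2 * i)) = 0 ->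
  (forall m, active 0 m -> `|s m| <= r) ->
  exists v : R -> R, [/\ Lip_r r v, interp N 0 (samples v) = v &
    forall m, active 0 m -> slope N (samples v) m = s m].
Proof.
move=> ps s0 sr.
have [V [Vs pV]] := discrete_antiderivative N0 ps s0.
pose v := interp N 0 V.
have vV m : active 1 m -> v (x_ m) = V m by move=> am; exact: interp_node.
exists v; split.
- split; first by apply: interp_periodic => // m _.
  by apply: interp_lipschitz => // m am; rewrite Vs // sr.
- exact: eq_interp.
- move=> m am; rewrite -Vs // /slope !vV //; move: am; rewrite /active; lia.
Qed.
(** Replaces the derivative of [v0], which exists only almost everywhere, by a step
    function with the same cell averages. *)
Lemma Lip_step_slope (v0 : R -> R) : Lip_r r v0 ->
  let u0 := step N (slope N (samples v0)) in
  Linf_r0 r u0 /\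
  forall m, active 0 m -> schemeU H N K c u0 0 m = slope N (samples v0) m.
Proof.
move=> [pv lv] u0.
have pV m := samples_period m pv.
have Lu0 : Linf_r0 r u0.
  apply: Linf_r0_step.
  - by move=> m _; exact: slope_period.
  - exact: sum_slope_eq0.
  - have d0 : 0 < 2 * mesh_dx R N by rewrite mulr_gt0 // mesh_dx_gt0.
    move=> m _; rewrite /slope normrM normfV (gtr0_norm d0) ler_pdivrMr //.
    have := lv (x_ (m + 1), x_ (m - 1)) _; rewrite /= => /(_ _)/le_trans; apply=> //.
    rewrite !mesh_xD mulN1r mul1r (_ : _ - _ = 2 * mesh_dx R N); last by ring.
    by rewrite gtr0_norm.
split=> // m am; apply: schemeU0_step => //.
  by case: Lu0 => -[].
exact: aeW.
Qed.

(** A fixed point of [phi_Delta] at time 1 agrees almost everywhere with a step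
    function [step N s].  Since [u] is exactly periodic and translations preserve null
    sets, the values [s] are periodic.  The bound passes to [s] because every cell has
    positive measure, and the zero mean because integrals ignore null sets. *)
Lemma fixed_point_grid (u : R -> R) : (0 < K)%N -> Linf_r0 r u ->
  ae_equal (phi_Delta H N K c 1 u) u ->
  let s := schemeU H N K c u (2 * K) in
  [/\ forall m, active 0 m -> schemeU H N K c u 0 m = s m,
      forall m, active 0 m -> s (m + Posz (2 * N)) = s m,
      \sum_(i < N) s (Posz (2 * i)) = 0 &
      forall m, active 0 m -> `|s m| <= r].
Proof.
move=> K0 [[mu' pu _ u0] ur] fp s.
have t1 : time_index K (1 : R) = (2 * K)%N by rewrite (time_index_nat R 1) // mul1n.
have su : ae_equal (step N s) u.
  move: fp; rewrite phi_DeltaE // t1 //; lia.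
have sr m : active 0 m -> `|s m| <= r.
  apply: (normLinf_step N0 s r).1; apply/normLinf_leP.
  by apply: ae_imply2 su ((normLinf_leP _ _).1 ur) => x /= ->.
have sp m : active 0 m -> s (m + Posz (2 * N)) = s m.
  move=> am.
  have h : {ae (@lebesgue_measure R), forall x, step N s (x + 1) = step N s x}.
    by apply: ae_imply2 (ae_shift 1 su) su => x /= -> ->; exact: pu.
  have [x xm] := ae_step N0 (P := fun x y => step N s (x + 1) = y) am h.
  by rewrite /step cell_index_period // (@cell_index_eq _ _ N0 0 m).
split=> //.
- by move=> m am; apply: schemeU0_step.
- move: u0; rewrite -(@eq_ae_Rintegral R _ (step N s)) //.
  + rewrite (Rintegral_step_period N0 sr) // => /eqP.
    rewrite mulf_eq0 gt_eqF /= => [/eqP //|].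
    by rewrite mulr_gt0 // mesh_dx_gt0.
  + apply: measurable_funS (measurable_step N0 s) => //.
  + apply: measurable_funS mu' => //.
  + by apply: ae_imply su => x.
Qed.

End Initial_data.

(** * Periodic states *)

Section Periodic_states.
Variables (R : realType) (H : R -> R -> R -> R) (N K : nat) (c r rho a : R).
Variable ubar : R -> R.
Hypotheses (hH : Hamiltonian H) (N0 : (0 < N)%N) (K0 : (0 < K)%N).
Hypothesis hcfl : forall u0, Linf_r0 r u0 -> forall k m, active k m ->
  `|derive1 (H (mesh_x R N m) (mesh_t R K k)) (c + schemeU H N K c u0 k m)|
    <= (mesh_lambda R N K)^-1.
Hypothesis hubar : unique_fixed_point H N K c r ubar.
Hypothesis hdecay : forall (u0 : R -> R) (t : nat), Linf_r0 r u0 ->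
  (normLinf (phi_Delta H N K c t%:R u0 \- phi_Delta H N K c t%:R ubar)%R
     <= (a * rho ^+ t)%:E)%E.
Local Notation x_ := (mesh_x R N).
Local Notation U := (schemeU H N K c).
Local Notation V := (schemeV H N K c).
Local Notation samples v0 := (fun m : int => v0 (x_ m)).

(** The solution of the cell problem, recorded by its grid values: its initial slopes
    are those of [ubar], and its nodal values return after one unit of time, which is
    [2 * K] steps. *)
Definition corrector (h : R) (vbar : R -> R) : Prop :=
  [/\ Lip_r r vbar, interp N 0 (samples vbar) = vbar,
      forall m, active 0 m -> U ubar 0 m = slope N (samples vbar) m &
      forall m, active 1 m -> V h vbar (2 * K) m = vbar (x_ m)].

Lemma corrector_exists : exists h vbar, corrector h vbar.
Proof.
have [Lu fp _] := hubar.
have [Us ps s0 sr] := fixed_point_grid N0 K0 Lu fp.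
set s := schemeU H N K c ubar (2 * K) in Us ps s0 sr.
have [v [Lv iv vs]] := Lip_interp_primitive N0 ps s0 sr.
pose W := V 0 v (2 * K).
(* Over one period the evolution with right-hand side 0 moves all nodes by the same
   amount, because its slopes are again those of [ubar]. *)
have drift i : W (2 * i + 1) - v (x_ (2 * i + 1)) = W 1 - v (x_ 1).
  have := @int_step_constant _ (fun i => W (2 * i + 1) - v (x_ (2 * i + 1))) _ i.
  rewrite mulr0 add0r; apply => {}i.
  have am k : active (2 * k) (2 * (i + 1)) by rewrite /active; lia.
  have e0 m : active 0 m -> U ubar 0 m = slope N (V 0 v 0) m.
    by move=> am0; rewrite Us // -vs.
  have := vs _ (am 0%N); rewrite -/s /s (schemeU_slope N0 e0 (am K)) -/W.
  have d0 : 2 * mesh_dx R N != 0 by rewrite gt_eqF // mulr_gt0 // mesh_dx_gt0.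
  rewrite /slope => /(divIf d0).
  rewrite (_ : 2 * (i + 1) - 1 = 2 * i + 1); last by lia.
  move=> e; apply/eqP; rewrite -subr_eq0; apply/eqP; move: e.
  by set A := v _; set B := v _; lra.
exists (v (x_ 1) - W 1), v; split=> //.
  by move=> m am; rewrite Us // vs.
move=> m am.
rewrite (@schemeV_shift _ H N K c _ 0 0 v v) => [|m' _|]; first last.
- by move: am; rewrite /active; lia.
- by rewrite addr0.
have [i em] : exists i : int, m = 2 * i + 1.
  by exists (m %/ 2)%Z; move: am; rewrite /active; lia.
have e1 : (2 * K)%:R * mesh_dt R K = 1.
  by rewrite natrM -mulrA mulrCA; exact: (mesh_dxN R K0).
rewrite em addr0 subr0 -/W e1 mulr1.
by have := drift i; lra.
Qed.

Lemma corrector_CFL (h : R) (v u : R -> R) : Linf_r0 r u ->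
  (forall m, active 0 m -> U u 0 m = slope N (samples v) m) ->
  CFL H N K c h v.
Proof.
move=> Lu e0 k m am; rewrite -(schemeU_slope N0 e0 am).
exact: hcfl.
Qed.

(** Along integer times, [D] below is the difference of the two evolutions at the
    odd nodes.  Its increments over one cell are cell widths times differences of the
    first scheme, so its oscillation over the [N] cells is at most [a * rho ^+ t];
    comparison in both directions then yields [d]. *)
Lemma corrector_attracts (h : R) (vbar v0 : R -> R) : corrector h vbar -> Lip_r r v0 ->
  exists d, forall (t : nat) m, active 1 m ->
    `|V h v0 (t * (2 * K)) m - (V h vbar (t * (2 * K)) m + d)| <= a * rho ^+ t.
Proof.
move=> [Lvbar _ ebar _] Lv.
have [Lubar _ _] := hubar.
have [Lu0 e0] := Lip_step_slope H K c N0 Lv.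
set u0 := step N _ in Lu0 e0.
have cv := corrector_CFL h Lu0 e0.
have cbar := corrector_CFL h Lubar ebar.
have actE t m := active_period 1 t K m.
have act0E t m := active_period 0 t K m.
have d0 : 0 < 2 * mesh_dx R N by rewrite mulr_gt0 // mesh_dx_gt0.
pose D (t : nat) (i : int) :=
  V h v0 (t * (2 * K)) (2 * i + 1) - V h vbar (t * (2 * K)) (2 * i + 1).
have act1 i : active 1 (2 * i + 1) by rewrite /active; lia.
have actP m : active 1 m -> exists i, m = 2 * i + 1.
  by rewrite /active => am; exists (m %/ 2)%Z; lia.
have Dstep t i : `|D t (i + 1) - D t i| <= 2 * mesh_dx R N * (a * rho ^+ t).
  have am : active (t * (2 * K)) (2 * i + 2) by rewrite act0E /active; lia.
  have := hdecay t Lu0.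
  have tn := time_index_nat R t K0.
  rewrite !phi_DeltaE // tn; [|by lia..].
  move=> /(normLinf_step N0 (fun m => U u0 (t * (2 * K)) m - U ubar (t * (2 * K)) m)).
  move=> /(_ (2 * i + 2)); rewrite -(act0E t) => /(_ am).
  rewrite (schemeU_slope (h := h) N0 e0 am).
  rewrite (schemeU_slope (h := h) N0 ebar am).
  rewrite /slope -mulrBl normrM normfV (gtr0_norm d0) ler_pdivrMr // [_ * (2 * _)]mulrC.
  rewrite (_ : 2 * i + 2 - 1 = 2 * i + 1); last by lia.
  rewrite (_ : 2 * i + 2 + 1 = 2 * (i + 1) + 1); last by lia.
  by congr (`|_| <= _); rewrite /D; ring.
have Dper t i : D t (i + Posz N) = D t i.
  rewrite /D (_ : 2 * (i + Posz N) + 1 = 2 * i + 1 + Posz (2 * N)); last by lia.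
  by case: Lv Lvbar => pv _ [pb _]; rewrite !schemeV_periodic_x.
have osc t i j : D t i - D t j <= a * rho ^+ t.
  rewrite (le_trans (ler_norm _)) //.
  rewrite (le_trans (periodic_oscillation N0 (Dper t) (Dstep t) i j)) //.
  by rewrite (mulrA N%:R (2 * mesh_dx R N) (a * rho ^+ t)) mesh_dxN // mul1r.
have up t s C : (forall i, D t i <= C) -> forall i, D (t + s)%N i <= C.
  move=> DC i; rewrite /D lerBlDl mulnDl.
  apply: schemeV_comparison => // [m|]; last by rewrite -mulnDl actE.
  by rewrite actE => /actP[j ->]; rewrite -lerBlDl; exact: DC.
have lo t s C : (forall i, C <= D t i) -> forall i, C <= D (t + s)%N i.
  move=> DC i; rewrite /D lerBrDl -lerBrDr mulnDl.
  apply: schemeV_comparison => // [m|]; last by rewrite -mulnDl actE.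
  by rewrite actE => /actP[j ->]; rewrite lerBrDr -lerBrDl; exact: DC.
have [d dP] := squeezed_constant 0 (E := fun t => a * rho ^+ t) osc up lo.
by exists d => t m /actP[i ->]; rewrite opprD addrA; exact: dP.
Qed.

Lemma corrector_psi (h : R) (vbar : R -> R) : corrector h vbar ->
  psi_Delta H N K c h 1 vbar = vbar /\
  forall t : R, 0 <= t ->
    psi_Delta H N K c h (t + 1) vbar = psi_Delta H N K c h t vbar.
Proof.
move=> [_ ib _ pb].
have per t : 0 <= t -> psi_Delta H N K c h (t + 1) vbar = psi_Delta H N K c h t vbar.
  move=> t0; rewrite !psi_DeltaE time_indexS //.
  set k := time_index K t.
  rewrite -(@eq_interp _ _ N0 _ (V h vbar (k + 2 * K)) (V h vbar k)).
    apply/funext => x; rewrite /interp.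
    by rewrite (@cell_index_parity _ _ N0 (k + 2 * K) k) //; lia.
  by move=> m am; rewrite schemeV_periodic_t.
split=> //.
by rewrite -[1]add0r per // psi_DeltaE time_index0.
Qed.

Lemma psi_Delta_shift (h d t : R) (v w : R -> R) :
  (forall k m, active k.+1 m -> V h w k m = V h v k m + d) ->
  psi_Delta H N K c h t w = psi_Delta H N K c h t v \+ cst d.
Proof.
by move=> e; rewrite !psi_DeltaE -interp_addcst //; apply: eq_interp => // m; exact: e.
Qed.

End Periodic_states.

Theorem theorem3p6 (R : realType) (H : R -> R -> R -> R) (hH : Hamiltonian H)
    (c0 c1 : R) (hc01 : c0 <= c1)
    (beta1 : R) (hbeta1 : 0 < beta1) (hentropy : entropy_bound H c0 c1 beta1)
    (r : R) (hr0 : 0 < r) (hr : beta1 + 1 <= r)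
    (lambda0 lambda1 delta : R) (hlambda0 : 0 < lambda0)
    (hlambda01 : lambda0 < lambda1) (hdelta : 0 < delta)
    (hstab : mesh_stability H c0 c1 beta1 r lambda0 lambda1 delta)
    (N K : nat) (hmesh : admissible_mesh lambda0 lambda1 delta N K)
    (c : R) (hc : c0 <= c <= c1)
    (ubar : R -> R) (hubar : unique_fixed_point H N K c r ubar)
    (rho a : R) (hrho : 0 < rho < 1) (ha : 0 < a)
    (hdecay : forall (u0 : R -> R) (t : nat), Linf_r0 r u0 ->
       (normLinf (phi_Delta H N K c t%:R u0 \- phi_Delta H N K c t%:R ubar)%R
          <= (a * rho ^+ t)%:E)%E) :
  exists hbar : R,
    (forall (v0 : R -> R) (d t : R), Lip_r r v0 -> 0 <= t ->
       psi_Delta H N K c hbar t (v0 \+ cst d)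
       = psi_Delta H N K c hbar t v0 \+ cst d) /\
    exists vbar : R -> R,
      [/\ Lip_r r vbar,
          psi_Delta H N K c hbar 1 vbar = vbar,
          forall t : R, 0 <= t ->
            psi_Delta H N K c hbar (t + 1) vbar = psi_Delta H N K c hbar t vbar,
          forall w : R -> R, Lip_r r w ->
            (forall t : R, 0 <= t ->
               psi_Delta H N K c hbar (t + 1) w = psi_Delta H N K c hbar t w) ->
            exists d : R, forall t : R, 0 <= t ->
              psi_Delta H N K c hbar t w
              = psi_Delta H N K c hbar t vbar \+ cst d
        & forall v0 : R -> R, Lip_r r v0 ->
            exists d : R, forall t : nat,
              (normC0 (psi_Delta H N K c hbar t%:R v0
                       \- psi_Delta H N K c hbar t%:R (vbar \+ cst d))%R
                 <= (a * rho ^+ t)%:E)%E].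
Proof.
have [N0 NK _ _] := hmesh.
have K0 : (0 < K)%N by apply: leq_trans NK.
have hcfl u0 : Linf_r0 r u0 -> forall k m, active k m ->
  `|derive1 (H (mesh_x R N m) (mesh_t R K k)) (c + schemeU H N K c u0 k m)|
    <= (mesh_lambda R N K)^-1.
  move=> Lu k m am; have [+ _] := hstab N K hmesh c hc u0 Lu.
  by move=> /(_ k m am)[le /ltW]; exact: le_trans.
have [h [vbar corr]] := corrector_exists N0 K0 hubar.
have attr v0 (Lv : Lip_r r v0) :=
  corrector_attracts hH N0 K0 hcfl hubar hdecay corr Lv.
have [Lvbar ivbar _ _] := corr.
have [fix1 per] := corrector_psi hH N0 K0 corr.
exists h; split.
  move=> v0 d t _ _; apply: psi_Delta_shift => // k m _; exact: schemeV_addcst.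
exists vbar; split=> //.
- move=> w Lw perw; have [d dP] := attr _ Lw.
  exists d => t _; apply: psi_Delta_shift => // k m am.
  rewrite (@schemeV_shift _ H N K c h h d w vbar) ?subrr ?mul0r ?addr0 //.
  move=> {k}{}m {}am.
  have nodes v n : (forall t : R, 0 <= t ->
      psi_Delta H N K c h (t + 1) v = psi_Delta H N K c h t v) ->
      schemeV H N K c h v (n * (2 * K)) m = v (mesh_x R N m).
    move=> pv; have : psi_Delta H N K c h n%:R v = psi_Delta H N K c h 0 v.
      by elim: n => [//|n IH]; rewrite -natr1 pv.
    move=> /(congr1 (fun f => f (mesh_x R N m))).
    rewrite !psi_DeltaE time_index0 time_index_nat //.
    by rewrite !interp_node ?(active_period 1 n K).
  (* The nodal values of w and vbar are the same at all integer times, while the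
     bound on their difference tends to 0. *)
  apply/eqP; rewrite -subr_eq0 -normr_le0.
  have lim0 : a * rho ^+ n @[n --> \oo] --> (0 : R).
    rewrite -[X in _ --> X](mulr0 a); apply: cvgMr; apply: cvg_expr.
    by case/andP: hrho => r0 r1; rewrite gtr0_norm.
  apply: (closed_cvg
    (fun y => `|w (mesh_x R N m) - (vbar (mesh_x R N m) + d)| <= y) _ _ _ lim0).
  + exact: closed_ge.
  + by apply: nearW => n; have := dP n m am; rewrite !nodes.
- move=> v0 Lv; have [d dP] := attr v0 Lv; exists d => t.
  apply: ub_ereal_sup => _ [x _ <-] /=; rewrite lee_fin.
  rewrite !psi_DeltaE time_index_nat //; apply: interp_dist => // m am.
  by rewrite schemeV_addcst; apply: dP; rewrite -(active_period 1 t K).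
Qed.
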